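(* Let $K$ be a field extension of $\mathbf k$ and let $\mathrm{Spec}(K)\to\overline{\mathscr J}_{\mathrm{bd}}^{2,g,n}$ be a point with associated double covering pair $(f:C\to\mathbb P^1_K,M)$. If $C$ is reducible and $M$ is a line bundle of bi-degree $(d_1,d_2)$, then $d_1\ge\frac n2-(g+1)$.
   Context: Work over a field $\mathbf k$ of characteristic $\neq 2$; $g,n$ are integers. A double cover $f:X\to T$ is a finite flat morphism of degree $2$. Given a double cover $f:X\to T$, an $\mathcal O_X$-module $M$ is traceable if (i) $f_*M$ is a locally free $\mathcal O_T$-module of rank $2$, and (ii) the composite $f_*\mathcal O_X\to \mathrm{End}_{\mathcal O_T}(f_*M)\to\mathcal O_T$ (multiplication followed by trace) equals the composite $f_*\mathcal O_X\to \mathrm{End}_{\mathcal O_T}(f_*\mathcal O_X)\to\mathcal O_T$. A double covering pair of $T$ is a pair $(f:X\to T,M)$ with $f$ a double cover and $M$ a traceable $\mathcal O_X$-module. A linear binary quadratic form on a scheme $S$ is a triple $(V,L,p)$ with $V$ a rank $2$ vector bundle, $L$ a line bundle and $p\in H^0(S,\mathrm{Sym}^2V\otimes L)$. There is a known functorial equivalence between linear binary quadratic forms on $S$ and double covering pairs $(f:X\to S,M)$, under which $V\cong f_*M$ and $f_*\mathcal O_X/\mathcal O_S\cong\wedge^2V^*\otimes L^*$; locally, if $V$ has basis $x,y$, $L$ has basis $z$ and $p=(ax^2+bxy+cy^2)z$, then $f_*\mathcal O_X$ has basis $1,\tau$, $f_*M$ has basis $x,y$, and $\tau^2=-b\tau-ac$,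 $\tau x=-cy-bx$, $\tau y=ax$. $\overline{\mathscr J}^{2,g,n}$ is the stack over $\mathbf k$ whose $T$-points are linear binary quadratic forms $(V,L,p)$ on $\mathbb P^1_T$ with $\deg V+\deg L-1=g$ and $2\deg V+\deg L=n$ on fibers over $T$; equivalently, double covering pairs $(f:C\to\mathbb P^1_T,M)$ whose fibers satisfy $p_a(C)=g$ and $\deg M:=\chi(M)-\chi(\mathcal O_C)=n$. With $k:=2g-n+2$, the open substack $\overline{\mathscr J}_{\mathrm{bd}}^{2,g,n}\subseteq\overline{\mathscr J}^{2,g,n}$ consists of those $(V,L,p)$ for which $\mathrm{Sym}^2(V)\otimes\mathcal O(k)$ is globally generated on fibers; its points are the forms $(\mathcal O(i)\oplus\mathcal O(j),\mathcal O(k),p)$ with $i\le j$ and $2i+k\ge0$. Bi-degree: if $C$ is a reduced, reducible curve with a double cover $C\to\mathbb P^1_K$, then $C=C_1\cup C_2$ with $C_1\cong C_2\cong\mathbb P^1$. The components are ordered so that $\deg(M|_{C_1})\le\deg(M|_{C_2})$, and the bi-degree of a line bundle $M$ on $C$ is $(d_1,d_2)$ with $d_i=\deg(M|_{C_i})$, so $d_1\le d_2$. *)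

(* Defs.v *)
From HB Require Import structures.
From mathcomp Require Import all_boot all_order all_algebra.
Set Implicit Arguments.
Unset Strict Implicit.
Unset Printing Implicit Defensive.
Import Order.TTheory GRing.Theory Num.Theory.
Local Open Scope ring_scope.

(* Geometry over the projective line P^1_K, K a field, via its two standard
   affine charts U0 = Spec K[t] and Uoo = Spec K[1/t].

   A locally free sheaf of finite rank on P^1_K embeds into the constant sheaf
   of its generic stalk W, a vector space over the function field K(t), and is
   determined by the sections on the two charts, as subsets of W.  Since K[t]
   and K[1/t] are principal ideal domains, its restriction to each chart is
   free.  A finite flat f : C -> P^1_K is affine, so C is the relative spectrum
   of the locally free algebra f_* O_C, and a quasi-coherent O_C-module M is a
   quasi-coherent f_* O_C-module. *)

Notation ratfun K := {fraction {poly K}}.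

Inductive chart : Set := U0 | Uoo.

Section ProjectiveLine.
Variable K : fieldType.
Local Notation F := (ratfun K).

Definition tP : F := tofrac 'X.
Definition cst (c : K) : F := tofrac c%:P.
Definition coord (u : chart) : F := if u is U0 then tP else tP^-1.

(* O_{P^1}(u) : polynomials in the coordinate of the chart u *)
Definition regular (u : chart) (f : F) : Prop :=
  exists p : {poly K}, f = (map_poly cst p).[coord u].

Local Notation sheaf W := (chart -> W -> Prop).

Section VectorBundles.
Variable W : lmodType F.

Definition comb r (c : 'rV[F]_r) (e : r.-tuple W) : W :=
  \sum_(i < r) c 0 i *: tnth e i.

(* e is a K(t)-basis of the generic stalk and an O(u)-basis of the sections *)
Definition frame (S : sheaf W) (u : chart) r (e : r.-tuple W) : Prop :=
  (forall w, exists! c : 'rV[F]_r, w = comb c e) /\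
  (forall c : 'rV[F]_r, S u (comb c e) <-> forall i, regular u (c 0 i)).

(* The second clause says that the two modules of sections have the same
   localization on the intersection of the two charts. *)
Definition vector_bundle r (S : sheaf W) : Prop :=
  (forall u, exists e : r.-tuple W, frame S u e) /\
  (forall u v w, S u w -> exists m : nat, S v (coord v ^+ m *: w)).

(* The determinant of the transition matrix is a unit of K[t, 1/t]. *)
Definition has_degree r (S : sheaf W) (d : int) : Prop :=
  exists (e0 eoo : r.-tuple W) (G : 'M[F]_r) (c : K),
    [/\ frame S U0 e0, frame S Uoo eoo,
        forall i, tnth eoo i = comb (row i G) e0,
        c != 0 & \det G = cst c * tP ^ d].

Definition global_section (S : sheaf W) (w : W) : Prop := forall u, S u w.

Definition globally_generated (S : sheaf W) : Prop :=
  forall u w, S u w ->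
    exists (m : nat) (s : 'I_m -> W) (a : 'I_m -> F),
      [/\ forall i, global_section S (s i), forall i, regular u (a i)
        & w = \sum_(i < m) a i *: s i].

End VectorBundles.

(* O(d), with generic stalk K(t) *)
Definition OP1 (d : int) : sheaf F^o :=
  fun u f => if u is U0 then regular u f else regular u (tP ^ (- d) * f).

(* Product K(t)^2 x K(t)^2 -> Sym^2 K(t)^2, the target with coordinates in the
   basis X^2, XY, Y^2. *)
Definition sym2 (v w : 'rV[F]_2) : 'rV[F]_3 :=
  \row_(i < 3) \sum_(j < 2) \sum_(l < 2 | (j + l == i)%N) v 0 j * w 0 l.

(* Sym^2 V (x) L inside its generic stalk *)
Definition sym2_twist (V : sheaf 'rV[F]_2) (L : sheaf F^o) : sheaf 'rV[F]_3 :=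
  fun u s => exists (m : nat) (v w : 'I_m -> 'rV[F]_2) (l : 'I_m -> F),
    [/\ forall i, V u (v i), forall i, V u (w i), forall i, L u (l i)
      & s = \sum_(i < m) l i *: sym2 (v i) (w i)].

(* A linear binary quadratic form on P^1_K; the generic stalks of V and L are
   identified with K(t)^2 and K(t) by a choice of bases. *)
Record linear_bqf := LinearBQF {
  bqf_V : sheaf 'rV[F]_2;
  bqf_L : sheaf F^o;
  bqf_p : 'rV[F]_3;
  bqf_V_bundle : vector_bundle 2 bqf_V;
  bqf_L_bundle : vector_bundle 1 bqf_L;
  bqf_p_section : global_section (sym2_twist bqf_V bqf_L) bqf_p
}.

(* K-points of Jbar^{2,g,n} and of its open substack Jbar_bd^{2,g,n} *)
Definition Jbar_point (g n : int) (Q : linear_bqf) : Prop :=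
  exists dV dL : int,
    [/\ has_degree 2 (bqf_V Q) dV, has_degree 1 (bqf_L Q) dL,
        dV + dL - 1 = g & 2 * dV + dL = n].

Definition Jbd_point (g n : int) (Q : linear_bqf) : Prop :=
  Jbar_point g n Q /\
  globally_generated (sym2_twist (bqf_V Q) (OP1 (2 * g - n + 2))).

(* dc_fun is the generic stalk of f_* O_C, and dc_sec u is the coordinate ring
   of the preimage of the chart u. *)
Record double_cover := DoubleCover {
  dc_fun : comAlgType F;
  dc_sec :> sheaf dc_fun;
  dc_bundle : vector_bundle 2 dc_sec;
  dc_one : forall u, dc_sec u 1;
  dc_mul : forall u a b, dc_sec u a -> dc_sec u b -> dc_sec u (a * b)
}.

(* An O_C-module M with f_* M locally free of rank 2, such that the trace of
   multiplication on f_* M agrees with that on f_* O_C. *)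
Record traceable_module (C : double_cover) := TraceableModule {
  tm_mod : lmodType F;
  tm_sec :> sheaf tm_mod;
  tm_act : dc_fun C -> tm_mod -> tm_mod;
  tm_bundle : vector_bundle 2 tm_sec;
  tm_actD : forall a m1 m2, tm_act a (m1 + m2) = tm_act a m1 + tm_act a m2;
  tm_Dact : forall a b m, tm_act (a + b) m = tm_act a m + tm_act b m;
  tm_actM : forall a b m, tm_act (a * b) m = tm_act a (tm_act b m);
  tm_actZ : forall (k : F) m, tm_act (k%:A) m = k *: m;
  tm_act_sec : forall u a m, C u a -> tm_sec u m -> tm_sec u (tm_act a m);
  tm_trace : forall u (e : 2.-tuple tm_mod) (b : 2.-tuple (dc_fun C)),
    frame tm_sec u e -> frame C u b ->
    forall (a : dc_fun C) (X Y : 'M[F]_2), C u a ->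
      (forall i, tm_act a (tnth e i) = comb (row i X) e) ->
      (forall i, a * tnth b i = comb (row i Y) b) ->
      \tr X = \tr Y
}.

(* (C, M) is the double covering pair of (V, L, p): phi is the isomorphism
   f_* M = V, and psi is the isomorphism
   f_* O_C / O = (wedge^2 V)^* (x) L^*, read on generic stalks with the target
   trivialized by the standard bases, so that the dual generator attached to
   local bases x, y of V and z of L is 1 / (det (x, y) z). *)
Definition associated (Q : linear_bqf) (C : double_cover)
    (M : traceable_module C) : Prop :=
  exists (phi : {linear tm_mod M -> 'rV[F]_2}) (psi : {linear dc_fun C -> F^o}),
    [/\ bijective phi,
        forall u m, M u m <-> bqf_V Q u (phi m),
        forall a, psi a = 0 <-> exists k : F, a = k%:A
      & forall u (x y : tm_mod M) (z : F^o) (a b c : F),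
          frame (bqf_V Q) u [tuple phi x; phi y] ->
          frame (bqf_L Q) u [tuple z] ->
          bqf_p Q = (z : F) *: (a *: sym2 (phi x) (phi x)
                      + b *: sym2 (phi x) (phi y) + c *: sym2 (phi y) (phi y)) ->
          exists tau : dc_fun C,
            frame C u [tuple 1; tau] /\
            [/\ tau * tau = - (b *: tau) - (a * c)%:A,
                tm_act tau x = - (c *: y) - b *: x,
                tm_act tau y = a *: x
              & psi tau = (\det (col_mx (phi x) (phi y)) * (z : F))^-1]].

Section Curve.
Variable C : double_cover.
Local Notation E := (dc_fun C).

Definition prime_ideal (u : chart) (P : E -> Prop) : Prop :=
  [/\ forall a, P a -> C u a,
      P 0 /\ (forall a b, P a -> P b -> P (a + b)),
      forall a b, C u a -> P b -> P (a * b),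
      ~ P 1
    & forall a b, C u a -> C u b -> P (a * b) -> P a \/ P b].

Definition minimal_prime (u : chart) (P : E -> Prop) : Prop :=
  prime_ideal u P /\
  forall P' : E -> Prop, prime_ideal u P' ->
    (forall a, P' a -> P a) -> forall a, P a -> P' a.

(* An irreducible component of C, with its reduced structure, given by its
   quasi-coherent ideal sheaf.  As C is flat over P^1, every component
   dominates P^1 and hence meets the preimages of both charts. *)
Definition component (P : chart -> E -> Prop) : Prop :=
  (forall u, minimal_prime u (P u)) /\
  (forall u v a, P u a -> exists m : nat, P v (coord v ^+ m *: a)).

Definition distinct (P P' : chart -> E -> Prop) : Prop :=
  ~ (forall u a, P u a <-> P' u a).

Definition reducible : Prop :=
  exists P1 P2, [/\ component P1, component P2 & distinct P1 P2].

Variable M : traceable_module C.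
Local Notation act := (@tm_act C M).

(* M is invertible: around every point P of C there is a basic open set D(h)
   on which M is free with basis the restriction of some m. *)
Definition line_bundle : Prop :=
  forall u (P : E -> Prop), prime_ideal u P ->
    exists (h : E) (m : tm_mod M),
      [/\ C u h, ~ P h, M u m,
          forall m', M u m' -> exists (N : nat) (a : E),
            C u a /\ act (h ^+ N) m' = act a m
        & forall a, C u a -> act a m = 0 -> exists N : nat, h ^+ N * a = 0].

Definition ideal_mul (P : chart -> E -> Prop) (u : chart)
    (w : tm_mod M) : Prop :=
  exists (r : nat) (a : 'I_r -> E) (m : 'I_r -> tm_mod M),
    [/\ forall i, P u (a i), forall i, M u (m i)
      & w = \sum_(i < r) act (a i) (m i)].

(* M restricted to the component C_i with ideal sheaf P has degree d: f maps
   C_i isomorphically to P^1, and M|C_i = M / PM is carried to O(d). *)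
Definition degree_on (P : chart -> E -> Prop) (d : int) : Prop :=
  exists q : {linear tm_mod M -> F^o},
    forall u,
      [/\ forall m, M u m -> OP1 d u (q m),
          forall s, OP1 d u s -> exists2 m, M u m & q m = s
        & forall m, M u m -> (q m = 0 <-> ideal_mul P u m)].

Definition bidegree (d1 d2 : int) : Prop :=
  exists P1 P2,
    [/\ component P1, component P2 & distinct P1 P2] /\
    [/\ degree_on P1 d1, degree_on P2 d2 & d1 <= d2].

End Curve.

End ProjectiveLine.

(* Main.v *)
From HB Require Import structures.
Require Import Defs.
From mathcomp Require Import all_boot all_order all_algebra.
From mathcomp Require Import ring lra.
Import Order.TTheory GRing.Theory Num.Theory.
Local Open Scope ring_scope.

(** Since [f_* M -> M|_{C_1} = O(d1)] is surjective, so is the induced map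
    [Sym^2 (f_* M) (x) O(k) -> O(2 d1 + k)], where [k = 2 g - n + 2].  The source
    is globally generated on the bounded locus, hence [O(2 d1 + k)] has a nonzero
    global section and [2 d1 + k >= 0]. *)

Section RegularFunctions.
Variable K : fieldType.
Local Notation F := (ratfun K).

Lemma cstE : @cst K = @tofrac {poly K} \o polyC. Proof. by []. Qed.

Lemma tP_neq0 : tP K != 0.
Proof. by rewrite tofrac_eq0 polyX_eq0. Qed.

Lemma regularD {u} {f1 f2 : F} : regular u f1 -> regular u f2 -> regular u (f1 + f2).
Proof. by move=> [p ->] [r ->]; exists (p + r); rewrite cstE rmorphD hornerD. Qed.

Lemma regularM {u} {f1 f2 : F} : regular u f1 -> regular u f2 -> regular u (f1 * f2).
Proof. by move=> [p ->] [r ->]; exists (p * r); rewrite cstE rmorphM hornerM. Qed.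

Lemma regular0 u : regular u (0 : F).
Proof. by exists 0; rewrite cstE rmorph0 horner0. Qed.

Lemma regular1 u : regular u (1 : F).
Proof. by exists 1; rewrite cstE rmorph1 hornerE. Qed.

Lemma regular_U0P {f : F} : regular U0 f -> exists p : {poly K}, f = @tofrac {poly K} p.
Proof.
move=> [p ->]; exists p.
by rewrite cstE map_poly_comp horner_map /= -[_.['X]]/(p \Po 'X) comp_polyXr.
Qed.

(** Multiplying a polynomial in [1/t] by a large enough power of [t] reverses its coefficients. *)
Lemma regular_UooP {f : F} : regular Uoo f ->
  exists (N : nat) (p : {poly K}),
    (size p <= N.+1)%N /\ tP K ^+ N * f = @tofrac {poly K} p.
Proof.
(* Taking [N = size r], one more than the degree, also covers [r = 0]. *)
move=> [r ->]; exists (size r), (\sum_(i < size r) r`_i *: 'X^(size r - i)).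
split.
  apply: leq_trans (size_sum _ _ _) _; apply/bigmax_leqP => i _.
  by apply: leq_trans (size_scale_leq _ _) _; rewrite size_polyXn ltnS leq_subr.
rewrite cstE horner_coef size_map_poly rmorph_sum mulr_sumr /=.
apply: eq_bigr => i _; rewrite coef_map /= -mul_polyC rmorphM rmorphXn /=.
rewrite mulrCA; congr (_ * _).
rewrite -{1}(subnK (ltnW (ltn_ord i))) exprD -mulrA exprVn mulfV ?mulr1 //.
by rewrite expf_neq0 // tP_neq0.
Qed.

Lemma OP1D {d u} {f1 f2 : F} :
  OP1 d u f1 -> OP1 d u f2 -> OP1 d u (f1 + f2).
Proof. by case: u => /=; rewrite ?mulrDr; exact: regularD. Qed.

Lemma OP1_0 d u : OP1 d u (0 : F).
Proof. by case: u => /=; rewrite ?mulr0; exact: regular0. Qed.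

Lemma OP1M {d1 d2 u} {f1 f2 : F} :
  OP1 d1 u f1 -> OP1 d2 u f2 -> OP1 (d1 + d2) u (f1 * f2).
Proof.
case: u => /= h1 h2; first exact: regularM.
by rewrite opprD expfzDr ?tP_neq0 // mulrACA; exact: regularM.
Qed.

(** For [d = -(m+1)] the section is a polynomial [p] for which [t^(N+m+1) p] has degree at most [N],
    which forces [p = 0]. *)
Lemma OP1_global_section_ge0 {d : int} {f : F^o} :
  global_section (OP1 d) f -> f != 0 -> 0 <= d.
Proof.
move=> hf f_neq0; case: d hf => // m hf.
have /regular_U0P[p fE] := hf U0.
have := hf Uoo; rewrite /= NegzE opprK => /regular_UooP[N [r [size_r]]].
rewrite fE mulrA -exprD -rmorphXn -rmorphM => /eqP.
rewrite tofrac_eq => /eqP rE.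
have p_neq0 : p != 0 by rewrite -tofrac_eq0 -fE.
move: size_r; rewrite -rE mulrC size_mulXn //.
have : (0 < size p)%N by rewrite size_poly_gt0.
by case: (size p) => // s _; rewrite addnS ltnS -addnA -[leqRHS]addn0 leq_add2l.
Qed.

End RegularFunctions.

Section SymmetricSquare.
Variable K : fieldType.
Local Notation F := (ratfun K).
Variable lam : {linear 'rV[F]_2 -> F^o}.

(** This is [Sym^2 lam] on generic stalks, followed by multiplication, in the coordinates
    [X^2, XY, Y^2]. *)
Definition sym2_form (s : 'rV[F]_3) : F^o :=
  s 0 0 * lam (delta_mx 0 0) ^+ 2
  + s 0 1 * (lam (delta_mx 0 0) * lam (delta_mx 0 1))
  + s 0 2 * lam (delta_mx 0 1) ^+ 2.

Lemma sym2_form_is_linear : linear sym2_form.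
Proof.
move=> a s s'; rewrite /sym2_form !mxE.
have E (x0 x1 x2 y0 y1 y2 l0 l1 : F) :
    (a * x0 + y0) * l0 ^+ 2 + (a * x1 + y1) * (l0 * l1) + (a * x2 + y2) * l1 ^+ 2
    = a * (x0 * l0 ^+ 2 + x1 * (l0 * l1) + x2 * l1 ^+ 2)
      + (y0 * l0 ^+ 2 + y1 * (l0 * l1) + y2 * l1 ^+ 2) by ring.
exact: E.
Qed.

HB.instance Definition _ :=
  GRing.isLinear.Build F 'rV[F]_3 F^o _ sym2_form sym2_form_is_linear.

Lemma sym2_form_sym2 v w : sym2_form (sym2 v w) = lam v * lam w.
Proof.
(* With the guard moved into the summand, each test [j + l == i] is decided by computation once the
   sums are expanded. *)
have sym2E i : sym2 v w 0 i =
    \sum_(j < 2) \sum_(l < 2) (if (j + l == i)%N then v 0 j * w 0 l else 0).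
  by rewrite mxE; apply: eq_bigr => j _; rewrite big_mkcond.
have sum2 (G : 'I_2 -> F) : \sum_(i < 2) G i = G 0 + G 1.
  by rewrite !big_ord_recl big_ord0 addr0; congr (_ + G _); apply: val_inj.
have lamE x : lam x = x 0 0 * lam (delta_mx 0 0) + x 0 1 * lam (delta_mx 0 1).
  rewrite {1}[x]row_sum_delta linear_sum /= [LHS]sum2.
  by congr (_ + _); rewrite linearZ.
rewrite (lamE v) (lamE w) /sym2_form !sym2E !sum2 /=.
have E (v0 v1 w0 w1 l0 l1 : F) :
    (v0 * w0 + 0 + (0 + 0)) * l0 ^+ 2 + (0 + v0 * w1 + (v1 * w0 + 0)) * (l0 * l1)
    + (0 + 0 + (0 + v1 * w1)) * l1 ^+ 2
    = (v0 * l0 + v1 * l1) * (w0 * l0 + w1 * l1) by ring.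
exact: E.
Qed.

Lemma sym2_form_twist {V : chart -> 'rV[F]_2 -> Prop} {d e : int} {u s} :
  (forall v, V u v -> OP1 d u (lam v)) ->
  sym2_twist V (OP1 e) u s -> OP1 (d + d + e) u (sym2_form s).
Proof.
move=> lamV [m [v [w [l [Vv Vw Ll ->]]]]]; rewrite linear_sum.
apply: (big_ind (OP1 (d + d + e) u)) => [|a b|i _]; [exact: OP1_0|exact: OP1D|].
by rewrite linearZ /= sym2_form_sym2 addrC; do 2?apply: OP1M; auto.
Qed.

(** Surjectivity of [lam] enters through a lift [v] of [1] over [U0]: the square of [v] maps to [1],
    so some global section generating it has nonzero image in [O(2d + e)]. *)
Lemma quotient_degree_ge0 {V : chart -> 'rV[F]_2 -> Prop} {d e : int} :
  globally_generated (sym2_twist V (OP1 e)) ->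
  (forall u v, V u v -> OP1 d u (lam v)) ->
  (exists2 v, V U0 v & lam v = 1) -> 0 <= d + d + e.
Proof.
move=> gen lamV [v Vv lam_v].
have : sym2_twist V (OP1 e) U0 (sym2 v v).
  exists 1%N, (fun=> v), (fun=> v), (fun=> 1); split=> //=.
    by move=> _; exact: (regular1 K).
  by rewrite big_ord1 scale1r.
move=> /gen[m [s [a [s_global _ vE]]]].
(* If every image vanished, expanding [sym2 v v] in the [s i] would give [1 = 0]. *)
have [i si_neq0] : exists i, sym2_form (s i) != 0.
  apply/existsP; apply: contraT => /existsPn s0.
  have := oner_neq0 F; rewrite -[1]mulr1 -lam_v -sym2_form_sym2 vE linear_sum.
  by rewrite big1 ?eqxx // => i _; rewrite linearZ /= (eqP (negbNE (s0 i))) scaler0.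
apply: OP1_global_section_ge0 si_neq0 => u.
exact: sym2_form_twist (lamV u) (s_global i u).
Qed.

End SymmetricSquare.

Theorem theorem5p4 (k K : fieldType) (iota : {rmorphism k -> K})
  (char_k : 2%N \notin [pchar k]) (g n : int)
  (Q : linear_bqf K) (HQ : Jbd_point g n Q)
  (C : double_cover K) (M : traceable_module C) (HCM : associated Q M)
  (HC : reducible C) (HM : line_bundle M)
  (d1 d2 : int) (Hd : bidegree M d1 d2) :
  (n%:~R / 2 - (g + 1)%:~R <= d1%:~R :> rat).
Proof.
have [_ gen] := HQ; have [phi [_ [[psi phiK psiK] phiV _ _]]] := HCM.
have [P1 [_ [_ [[q qP] _ _]]]] := Hd.
(* The inverse of [phi] carries the restriction [q] of [M] to the first component over to a
   functional [q \o psi'] on the generic stalk of [V]. *)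
have psi_linear : linear psi by exact: can2_linear phiK psiK.
pose psiL := GRing.isLinear.Build _ _ _ _ psi psi_linear.
pose psi' : {linear 'rV[ratfun K]_2 -> tm_mod M} := HB.pack psi psiL.
have : 0 <= d1 + d1 + (2 * g - n + 2).
  apply: (@quotient_degree_ge0 K (q \o psi') _ _ _ gen) => [u v Vv|].
    by have [qM _ _] := qP u; apply: qM; apply/phiV; rewrite psiK.
  have [_ qM _] := qP U0; have [m Mm qm] := qM 1 (regular1 _ U0).
  by exists (phi m); [apply/phiV|rewrite /= phiK].
(* Over the rationals, half of [2 d1 + 2 g - n + 2 >= 0] is the claimed bound. *)
rewrite -(ler0z rat) !(rmorphD, rmorphB, rmorphM) /=.
lra.
Qed.
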